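(* Let $n \ge 1$ and $d \ge 1$ be positive integers, and write $n = q(d+1)+r$ with $q, r$ integers and $0 \le r \le d$. Then any graph on $n$ vertices with maximum degree $d$ has at most $$q\binom{d+1}{3}+\binom{r}{3}$$ triangles.
   Context: Graphs are finite, simple and undirected (no loops, no multiple edges). The maximum degree of a graph is the maximum of the degrees of its vertices. A triangle is a set of three pairwise adjacent vertices (triangles are counted unordered). The binomial coefficient $\binom{m}{3}$ is $0$ for integers $0 \le m \le 2$. *)

(* Defs.v *)
From HB Require Import structures.
From mathcomp Require Import all_boot.

Set Implicit Arguments.
Unset Strict Implicit.
Unset Printing Implicit Defensive.

Definition simple_graph (V : finType) (e : rel V) : Prop :=
  symmetric e /\ irreflexive e.

Definition neighbours (V : finType) (e : rel V) (x : V) : {set V} :=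
  [set y | e x y].

Definition degree (V : finType) (e : rel V) (x : V) : nat :=
  #|neighbours e x|.

(* On an empty vertex type this is 0. *)
Definition max_degree (V : finType) (e : rel V) : nat :=
  \max_(x : V) degree e x.

Definition is_triangle (V : finType) (e : rel V) (A : {set V}) : bool :=
  (#|A| == 3) && [forall x in A, forall y in A, (x != y) ==> e x y].

Definition triangles (V : finType) (e : rel V) : {set {set V}} :=
  [set A : {set V} | is_triangle e A].

(* Main.v *)
Require Import Defs.
From HB Require Import structures.
From mathcomp Require Import all_boot.
From mathcomp Require Import zify.

(** Write [N[z]] for the closed neighbourhood of [z], and [t(z)] for the number
    of triangles that meet [N[z]].

    The heart of the proof is the inequality [sum_z t(z) <= sum_z 'C(deg z + 1, 3)]
    ([sum_triangles_meeting_le]).  Its left side counts pairs (z, A) with A a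
    triangle touching [N[z]]; its right side counts pairs (z, A) with A any
    3-set inside [N[z]].  Passing to ordered triples, both sides become sums over
    ordered quadruples (z, u, v, w), and the inequality already holds after
    averaging over the four choices of which entry plays the part of z: on four
    given vertices this is a finite check ([exchange_quadruple]).  Four distinct
    vertices that span K4 count 4 times on each side; K4 minus an edge counts
    twice on each side (for the two vertices of degree 2 on the left, for the two
    of degree 3 on the right); a triangle with a pendant edge counts once on each
    side (for the pendant vertex on the left, for its neighbour on the right);
    any other graph contributes nothing on the left.

    Hence some vertex v has [t(v) <= 'C(m, 3)] with [m = deg v + 1]
    ([exists_cheap_vertex]).  Deleting [N[v]] destroys at most ['C(m, 3)]
    triangles and exactly m vertices, so induction on the number of vertices
    applies.  The bound for [n - m] vertices plus ['C(m, 3)] is at most the bound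
    for n, because ['C(m, 3)] is convex in m
    ([binS3_convex]): either m is taken out of the remainder r, or a complete
    block of d + 1 vertices has to be broken.

    To stay on one vertex type, deleting vertices means deleting the edges at
    them; a set S that carries all the edges plays the part of the vertex set. *)

(** * Convexity of the binomial coefficient *)

Lemma binS3_convex r a b :
  'C(r + a, 3) + 'C(r + b, 3) <= 'C(r, 3) + 'C(r + a + b, 3).
Proof.
elim: a => [|a IH]; first by rewrite addn0.
rewrite addnS addSn !binS.
have := @leq_bin2l (r + a) (r + a + b) 2 (leq_addr _ _).
lia.
Qed.

(** * Ordered triples *)

Lemma card_set3 {V : finType} (u v w : V) :
  uniq [:: u; v; w] -> #|[set u; v; w]| = 3.
Proof.
move=> U; have -> : [set u; v; w] = [set x in [:: u; v; w]].
  by apply/setP=> x; rewrite !inE orbA.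
by rewrite cardsE (card_uniqP U).
Qed.

Lemma card_triples_of_set {V : finType} (A : {set V}) : #|A| = 3 ->
  \sum_(u : V) \sum_(v : V) \sum_(w : V)
     (uniq [:: u; v; w] && ([set u; v; w] == A)) = 6.
Proof.
move=> cA.
have eqA u v w : uniq [:: u; v; w] && ([set u; v; w] == A)
   = [&& u \in A, v \in A :\ u & w \in A :\ u :\ v].
  apply/idP/idP.
    case/andP=> /= /and3P [U1 U2 _] /eqP <-.
    move: U1 U2; rewrite !inE !negb_or !eqxx => /andP[uv uw] vw.
    by rewrite (eq_sym v u) (eq_sym w u) (eq_sym w v) uv uw vw !orbT.
  rewrite !inE => /and3P[Au /andP[vu Av] /and3P[wv wu Aw]].
  have U : uniq [:: u; v; w].
    by rewrite /= !inE negb_or (eq_sym u v) (eq_sym u w) (eq_sym v w) vu wu wv.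
  rewrite U eqEcard cA card_set3 // andbT andTb.
  by apply/subsetP=> x; rewrite !inE => /orP[/orP[]|] /eqP->.
have sumb (B : {set V}) (F : V -> nat) c : (forall x, x \in B -> F x = c) ->
    (forall x, x \notin B -> F x = 0) -> \sum_x F x = #|B| * c.
  move=> FB FnB; rewrite (bigID (mem B)) /= [X in _ + X]big1 // addn0.
  by rewrite (eq_bigr (fun=> c)) // sum_nat_const.
rewrite (sumb A _ 2) ?cA // => u Au; last first.
  by apply: big1 => v _; apply: big1 => w _; rewrite eqA (negPf Au).
have cAu : #|A :\ u| = 2 by have := cardsD1 u A; rewrite Au cA; lia.
rewrite (sumb (A :\ u) _ 1) ?cAu // => v Av; last first.
  by apply: big1 => w _; rewrite eqA (negPf Av) andbF.
have cAv : #|A :\ u :\ v| = 1.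
  by have := cardsD1 v (A :\ u); rewrite Av cAu; lia.
rewrite (sumb (A :\ u :\ v) _ 1) ?cAv // => w Aw.
  by rewrite eqA Au Av Aw.
by rewrite eqA (negPf Aw) !andbF.
Qed.

Lemma card_ordered_triples {V : finType} (P : pred {set V}) :
  \sum_(u : V) \sum_(v : V) \sum_(w : V)
     (uniq [:: u; v; w] && P [set u; v; w])
  = 6 * #|[set A : {set V} | (#|A| == 3) && P A]|.
Proof.
pose Q A := (#|A : {set V}| == 3) && P A.
transitivity (\sum_(A | Q A) \sum_(u : V) \sum_(v : V) \sum_(w : V)
                 (uniq [:: u; v; w] && ([set u; v; w] == A))); last first.
  rewrite (eq_bigr (fun=> 6)); last first.
    by move=> A /andP[/eqP cA _]; apply: card_triples_of_set.
  rewrite sum_nat_const mulnC; congr (_ * _).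
  by apply: eq_card => A; rewrite !inE.
rewrite [RHS]exchange_big; apply: eq_bigr => u _.
rewrite [RHS]exchange_big; apply: eq_bigr => v _.
rewrite [RHS]exchange_big; apply: eq_bigr => w _.
have [U|nU] := boolP (uniq [:: u; v; w]); last by rewrite big1.
rewrite big_mkcond (bigD1 [set u; v; w]) //= big1 ?addn0 => [|A neA].
  by rewrite /Q card_set3 // !eqxx; case: (P _).
by rewrite (eq_sym _ A) (negPf neA); case: (Q A).
Qed.

(** * The averaged neighbourhood inequality *)

(** Here [c] is adjacency or equality.  Using this closed relation on both sides
    lets one inequality cover the triangles that contain the centre as well as
    those that only have a neighbour of it: if [z = u], the two equal terms on
    the left say that z, v, w is a triangle, and then z sees v and w, which the
    two corresponding terms on the right record. *)
Lemma exchange_quadruple {V : finType} (c : rel V)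
    (f := fun z u v w => uniq [:: u; v; w] &&
            ([&& c u v, c u w & c v w] && [|| c z u, c z v | c z w]))
    (g := fun z u v w => uniq [:: u; v; w] && [&& c z u, c z v & c z w])
    (z u v w : V) :
  symmetric c -> reflexive c ->
  f z u v w + f u z v w + f v z u w + f w z u v <=
  g z u v w + g u z v w + g v z u w + g w z u v.
Proof.
move=> cs cr; rewrite /f /g /= !inE !negb_or.
have [Ezu|_] := eqVneq z u; try rewrite -?Ezu;
have [Ezv|_] := eqVneq z v; try rewrite -?Ezv;
have [Ezw|_] := eqVneq z w; try rewrite -?Ezw;
have [Euv|_] := eqVneq u v; try rewrite -?Euv;
have [Euw|_] := eqVneq u w; try rewrite -?Euw;
have [Evw|_] := eqVneq v w; try rewrite -?Evw.
all: rewrite ?eqxx ?cr ?(cs u z) ?(cs v z) ?(cs w z) ?(cs v u) ?(cs w u) /=.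
all: rewrite ?(cs w v) ?(eq_sym u z) ?(eq_sym v z) ?(eq_sym v u) ?andbF //.
all: case: (c z u); case: (c z v); case: (c z w) => //.
all: case: (c u v); case: (c u w); case: (c v w) => //.
(* Substituting equal vertices can bring back an equality test already decided. *)
all: by case: (z == u); case: (z == v); case: (u == v).
Qed.

Lemma sum_over_centres {V : finType} (F : V -> V -> V -> V -> nat) :
  \sum_z \sum_u \sum_v \sum_w (F z u v w + F u z v w + F v z u w + F w z u v)
  = 4 * \sum_z \sum_u \sum_v \sum_w F z u v w.
Proof.
have E1 : \sum_z \sum_u \sum_v \sum_w F u z v w
        = \sum_z \sum_u \sum_v \sum_w F z u v w by rewrite exchange_big.
have E2 : \sum_z \sum_u \sum_v \sum_w F v z u w
        = \sum_z \sum_u \sum_v \sum_w F z u v w.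
  by rewrite -E1; apply: eq_bigr => z _; rewrite exchange_big.
have E3 : \sum_z \sum_u \sum_v \sum_w F w z u v
        = \sum_z \sum_u \sum_v \sum_w F z u v w.
  rewrite -E2; apply: eq_bigr => z _; apply: eq_bigr => u _.
  by rewrite exchange_big.
transitivity (\sum_z \sum_u \sum_v \sum_w F z u v w
  + \sum_z \sum_u \sum_v \sum_w F u z v w
  + \sum_z \sum_u \sum_v \sum_w F v z u w
  + \sum_z \sum_u \sum_v \sum_w F w z u v); last by rewrite E1 E2 E3; lia.
rewrite -!big_split; apply: eq_bigr => z _.
rewrite -!big_split; apply: eq_bigr => u _.
rewrite -!big_split; apply: eq_bigr => v _.
by rewrite -!big_split.
Qed.

Definition closed_nbhd {V : finType} (e : rel V) (z : V) : {set V} :=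
  z |: neighbours e z.

Definition triangles_meeting {V : finType} (e : rel V) (B : {set V}) :
  {set {set V}} := [set A in triangles e | ~~ [disjoint A & B]].

Lemma in_closed_nbhd {V : finType} (e : rel V) z x :
  (x \in closed_nbhd e z) = (z == x) || e z x.
Proof. by rewrite !inE eq_sym. Qed.

Lemma card_closed_nbhd {V : finType} (e : rel V) z : irreflexive e ->
  #|closed_nbhd e z| = (degree e z).+1.
Proof. by move=> ei; rewrite cardsU1 inE ei. Qed.

Lemma is_triangle_set3 {V : finType} (e : rel V) (c := fun x y => (x == y) || e x y)
    u v w : symmetric e -> uniq [:: u; v; w] ->
  is_triangle e [set u; v; w] = [&& c u v, c u w & c v w].
Proof.
move=> es U; rewrite /is_triangle card_set3 //.
have cE x y : (x != y) ==> e x y = c x y by rewrite /c implyNb.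
apply/idP/idP => [/andP[_ /'forall_in_forall_inP H]|/and3P[uv uw vw]].
  by rewrite -!cE !H // !inE eqxx ?orbT.
rewrite eqxx /=; apply/'forall_in_forall_inP => x + y.
rewrite !inE -!orbA cE.
have cs a b : c a b = c b a by rewrite /c eq_sym es.
by case/or3P=> /eqP-> /or3P[] /eqP->; rewrite // 1?cs // /c eqxx.
Qed.

Lemma sum_triangles_meeting_le {V : finType} (e : rel V) :
  symmetric e -> irreflexive e ->
  \sum_z #|triangles_meeting e (closed_nbhd e z)|
    <= \sum_z 'C((degree e z).+1, 3).
Proof.
move=> es ei; pose c x y := (x == y) || e x y.
have cs : symmetric c by move=> x y; rewrite /c eq_sym es.
have cr : reflexive c by move=> x; rewrite /c eqxx.
have L z : 6 * #|triangles_meeting e (closed_nbhd e z)| =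
   \sum_u \sum_v \sum_w (uniq [:: u; v; w] &&
     ([&& c u v, c u w & c v w] && [|| c z u, c z v | c z w])).
  transitivity (6 * #|[set A : {set V} | (#|A| == 3) &&
      (is_triangle e A && ~~ [disjoint A & closed_nbhd e z])]|).
    congr (_ * _); apply: eq_card => A; rewrite !inE /is_triangle.
    by rewrite !andbA andbb.
  rewrite -card_ordered_triples.
  apply: eq_bigr => u _; apply: eq_bigr => v _; apply: eq_bigr => w _.
  have [U|//] := boolP (uniq _); rewrite is_triangle_set3 //.
  congr (nat_of_bool (_ && (_ && _))).
  apply/idP/idP => [/pred0Pn[x /andP[/= Ax]]|H].
    rewrite in_closed_nbhd -/(c z x).
    by move: Ax; rewrite !inE -orbA => /or3P[]/eqP-> ->; rewrite ?orbT.
  apply/pred0Pn; case/or3P: H => H; [exists u | exists v | exists w];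
    by rewrite /= in_closed_nbhd -/(c _ _) H !inE eqxx ?orbT.
have R z : 6 * 'C((degree e z).+1, 3) =
   \sum_u \sum_v \sum_w (uniq [:: u; v; w] && [&& c z u, c z v & c z w]).
  rewrite -(card_closed_nbhd _ z ei) -cards_draws.
  transitivity (6 * #|[set A : {set V} | (#|A| == 3) &&
      (A \subset closed_nbhd e z)]|).
    by congr (_ * _); apply: eq_card => A; rewrite !inE andbC.
  rewrite -card_ordered_triples.
  apply: eq_bigr => u _; apply: eq_bigr => v _; apply: eq_bigr => w _.
  congr (nat_of_bool (_ && _)).
  by rewrite !subUset !sub1set !in_closed_nbhd -andbA.
rewrite -(leq_pmul2l (isT : 0 < 6)) !big_distrr /=.
rewrite (eq_bigr _ (fun z _ => L z)) (eq_bigr _ (fun z _ => R z)).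
rewrite -(leq_pmul2l (isT : 0 < 4)) -!sum_over_centres.
apply: leq_sum => z _; apply: leq_sum => u _; apply: leq_sum => v _.
by apply: leq_sum => w _; exact: exchange_quadruple.
Qed.

(** * Removing a closed neighbourhood *)

(** A vertex outside [S] is isolated, so it contributes 0 to both sides of the
    averaged inequality; this is why the vertex can be found inside [S]. *)
Lemma exists_cheap_vertex {V : finType} (e : rel V) (S : {set V}) :
  symmetric e -> irreflexive e -> (forall x y, e x y -> x \in S) ->
  S != set0 ->
  exists2 v, v \in S &
    #|triangles_meeting e (closed_nbhd e v)| <= 'C((degree e v).+1, 3).
Proof.
move=> es ei eS S0.
apply/exists_inP; apply: contraT; rewrite negb_exists_in => /forall_inP H.
have := sum_triangles_meeting_le _ es ei; rewrite leqNgt => /negP[].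
rewrite (bigID (mem S)) /= [X in _ + X]big1 ?addn0 => [|z zS]; last first.
  rewrite /degree (_ : neighbours e z = set0) ?cards0 //.
  apply/setP => y; rewrite !inE; apply/negP => /eS.
  by rewrite (negPf zS).
rewrite [X in _ < X](bigID (mem S)) /=; apply: leq_trans (leq_addr _ _).
have [x xS] := set0Pn _ S0.
rewrite (bigD1 x) //= [X in _ < X](bigD1 x) //= -addSn.
apply: leq_add; first by rewrite ltnNge H.
by apply: leq_sum => y /andP[yS _]; rewrite ltnW // ltnNge H.
Qed.

Lemma card_triangles_le {V : finType} (d : nat) (S : {set V}) (e : rel V) q r :
  symmetric e -> irreflexive e -> (forall x y, e x y -> x \in S) ->
  (forall x, degree e x <= d) -> #|S| = q * d.+1 + r -> r <= d ->
  #|triangles e| <= q * 'C(d.+1, 3) + 'C(r, 3).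
Proof.
have [n] := ubnP #|S|; elim: n => // n IH in S e q r *.
rewrite ltnS => Sn es ei eS ed cS rd.
have [S0|S0] := eqVneq S set0.
  suff -> : triangles e = set0 by rewrite cards0.
  apply/setP => A; rewrite !inE; apply/negP => /andP[/eqP cA].
  move=> /'forall_in_forall_inP H.
  have /card_gt1P [x [y [xA yA xy]]] : 1 < #|A| by rewrite cA.
  by have := eS _ _ (implyP (H x xA y yA) xy); rewrite S0 inE.
have [v vS cheap] := exists_cheap_vertex _ _ es ei eS S0.
set N := closed_nbhd e v in cheap; set m := (degree e v).+1 in cheap.
have cN : #|N| = m by exact: card_closed_nbhd.
have NS : N \subset S.
  apply/subsetP=> x; rewrite in_closed_nbhd => /orP[/eqP<- //|].
  by rewrite es; apply: eS.
pose e' := [rel x y | [&& e x y, x \notin N & y \notin N]].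
have split_triangles : #|triangles e| <= 'C(m, 3) + #|triangles e'|.
  rewrite -(cardsID (triangles_meeting e N)); apply: leq_add.
    by apply: leq_trans cheap; apply: subset_leq_card; apply: subsetIr.
  apply: subset_leq_card; apply/subsetP => A.
  rewrite !inE => /andP[+ TA]; rewrite TA /= negbK => dAN.
  case/andP: TA => cA /'forall_in_forall_inP H; rewrite /is_triangle cA /=.
  have AN x : x \in A -> x \notin N by move=> xA; rewrite (disjointFr dAN).
  apply/'forall_in_forall_inP => x xA y yA; apply/implyP => xy.
  by rewrite /= (implyP (H x xA y yA) xy) !AN.
have cS' : #|S :\: N| = #|S| - m.
  by rewrite cardsD (setIidPr NS) cN.
have mS : m <= #|S| by rewrite -cN subset_leq_card.
have md : m <= d.+1 by rewrite ltnS.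
have m0 : 0 < m by [].
have rest q' r' : #|S| - m = q' * d.+1 + r' -> r' <= d ->
    #|triangles e'| <= q' * 'C(d.+1, 3) + 'C(r', 3).
  rewrite -cS' => cS'' r'd; apply: (IH (S :\: N)) => //.
  - by rewrite cS'; lia.
  - by move=> x y /=; rewrite es (andbC (x \notin N)).
  - by move=> x /=; rewrite ei.
  - by move=> x y /= /and3P[/eS xS xN _]; rewrite inE xN.
  - move=> x; apply: leq_trans (ed x); apply: subset_leq_card.
    by apply/subsetP => y; rewrite !inE => /andP[].
have [mr|rm] := leqP m r.
  have := rest q (r - m) ltac:(lia) ltac:(lia).
  have := binS3_convex 0 m (r - m); rewrite !add0n subnKC //.
  lia.
(* The remainder is too small to supply [m] vertices: a block of [d + 1] is broken. *)
case: q cS => [|q] cS; first by lia.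
have := rest q (d.+1 + r - m) ltac:(lia) ltac:(lia).
have := binS3_convex r (m - r) (d.+1 - m).
rewrite (_ : r + (m - r) = m); last by lia.
rewrite (_ : m + (d.+1 - m) = d.+1); last by lia.
rewrite (_ : r + (d.+1 - m) = d.+1 + r - m); last by lia.
by rewrite mulSn; lia.
Qed.

Theorem theorem1 (n d q r : nat) (hn : 1 <= n) (hd : 1 <= d)
    (hnqr : n = q * (d + 1) + r) (hr : r <= d)
    (V : finType) (e : rel V) (he : simple_graph e)
    (hV : #|V| = n) (hmax : max_degree e = d) :
  #|triangles e| <= q * 'C(d + 1, 3) + 'C(r, 3).
Proof.
case: he => es ei; rewrite addn1; apply: (card_triangles_le d [set: V]) => //.
- by move=> x; rewrite -hmax; apply: leq_bigmax.
- by rewrite cardsT hV hnqr addn1.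
Qed.
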